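(* Let $S$ be a semigroup, and $s_1,s_2,t_1,t_2\in S$. (1) If $s_1\sim_s^1 t_1$ and $s_2\sim_s^1 t_2$, then $s_1s_2\sim_s^1 t_1t_2$. (2) If $s_1\sim_s t_1$ and $s_2\sim_s t_2$, then $s_1s_2\sim_s t_1t_2$. (3) If $s_1\sim_s^1 t_1$, then $s_1^n\sim_s^1 t_1^n$ for all positive integers $n$. (4) If $s_1\sim_s t_1$, then $s_1^n\sim_s t_1^n$ for all positive integers $n$.
   Context: For a semigroup $S$, $S^1$ denotes the monoid obtained by adjoining an identity element $1$ to $S$; if $S$ is already a monoid, $S^1=S$. For $s,t\in S$, $s\sim_s^1 t$ means there exist a positive integer $n$, elements $p_1,\dots,p_n\in S^1$, and a permutation $f$ of $\{1,\dots,n\}$ with $s=p_1\cdots p_n$ and $t=p_{f(1)}\cdots p_{f(n)}$; $\sim_s$ is the transitive closure of $\sim_s^1$. *)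

(* Defs.v *)
From HB Require Import structures.
From Stdlib Require Relation_Operators.
From mathcomp Require Import all_boot all_fingroup.
From mathcomp Require Import boolp.

Set Implicit Arguments.
Unset Strict Implicit.
Unset Printing Implicit Defensive.

Local Open Scope group_scope.

Section Adjoin1.
Variable S : semigroupType.

Definition is_identity (e : S) : Prop :=
  (forall x : S, e * x = x) /\ (forall x : S, x * e = x).

Definition has_identity : Prop := exists e : S, is_identity e.

(* S^1: the extra point None is present only when S has no identity; otherwise
   S^1 consists of the points Some s and is a copy of S. *)
Definition in_adjoin1 (x : option S) : bool :=
  isSome x || ~~ `[< has_identity >].

Definition adjoin1 : Type := {x : option S | in_adjoin1 x}.

HB.instance Definition _ := Choice.on adjoin1.

Definition to_adjoin1 (s : S) : adjoin1 := exist in_adjoin1 (Some s) isT.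

(* None acts as an identity. *)
Definition omul (x y : option S) : option S :=
  match x, y with
  | None, _ => y
  | _, None => x
  | Some a, Some b => Some (a * b)
  end.

Lemma omul_closed (x y : option S) :
  in_adjoin1 x -> in_adjoin1 y -> in_adjoin1 (omul x y).
Proof. by case: x y => [a|] [b|]. Qed.

Definition adjoin1_mul (x y : adjoin1) : adjoin1 :=
  exist in_adjoin1 (omul (sval x) (sval y)) (omul_closed (svalP x) (svalP y)).

Lemma adjoin1_None (h : ~ has_identity) : in_adjoin1 None.
Proof. by apply/negP => /asboolP. Qed.

Definition adjoin1_one : adjoin1 :=
  match pselect has_identity with
  | left h => to_adjoin1 (sval (cid h))
  | right h => exist in_adjoin1 None (adjoin1_None h)
  end.

Lemma adjoin1_mulA : associative adjoin1_mul.
Proof.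
by move=> [[a|] ?] [[b|] ?] [[c|] ?]; apply: val_inj; rewrite /= ?mulgA.
Qed.

Lemma adjoin1_mul1 : left_id adjoin1_one adjoin1_mul.
Proof.
move=> x; apply: val_inj; rewrite /= /adjoin1_one; case: pselect => //= h.
case: x => [[a|] /= ax]; first by rewrite (proj1 (svalP (cid h))).
by case/negP: ax; apply/asboolP.
Qed.

Lemma adjoin1_mulr1 : right_id adjoin1_one adjoin1_mul.
Proof.
move=> x; apply: val_inj; rewrite /= /adjoin1_one; case: pselect => [h|h] /=.
  case: x => [[a|] /= ax]; first by rewrite (proj2 (svalP (cid h))).
  by case/negP: ax; apply/asboolP.
by case: x => [[a|]].
Qed.

HB.instance Definition _ :=
  isMonoid.Build adjoin1 adjoin1_mulA adjoin1_mul1 adjoin1_mulr1.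

Lemma to_adjoin1_inj : injective to_adjoin1.
Proof. by move=> s t []. Qed.

Lemma to_adjoin1M (s t : S) : to_adjoin1 (s * t) = to_adjoin1 s * to_adjoin1 t.
Proof. exact: val_inj. Qed.

Lemma to_adjoin1_surj : has_identity -> forall x, exists s, x = to_adjoin1 s.
Proof.
move=> h [[a|] ax]; first by exists a; apply: val_inj.
by case/negP: (ax); apply/asboolP.
Qed.

Lemma to_adjoin1_compl :
  ~ has_identity -> forall x, x = 1 \/ exists s, x = to_adjoin1 s.
Proof.
move=> h [[a|] ax]; [right; exists a | left]; apply: val_inj => //=.
by rewrite /one /= /adjoin1_one; case: pselect.
Qed.

Lemma to_adjoin1_neq1 : ~ has_identity -> forall s, to_adjoin1 s <> 1.
Proof.
by move=> h s; rewrite /one /= /adjoin1_one; case: pselect.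
Qed.

End Adjoin1.

Section PermutedProducts.
Variable S : semigroupType.

(* The relation ~_s^1; the letters p i lie in S^1, while s and t lie in S. *)
Definition sim1 (s t : S) : Prop :=
  exists (n : nat) (p : 'I_n -> adjoin1 S) (f : 'S_n),
    [/\ (0 < n)%N,
        to_adjoin1 s = \prod_(i < n) p i
      & to_adjoin1 t = \prod_(i < n) p (f i)].

(* The relation ~_s. *)
Definition sim : S -> S -> Prop := @Relation_Operators.clos_trans S sim1.

(* s^n for n > 0; a semigroup has no s^0, and the value s at n = 0 is
   arbitrary. *)
Definition sgpow (s : S) (n : nat) : S := iterop n (@mul S) s s.

End PermutedProducts.

(* Main.v *)
Require Import Defs.
From mathcomp Require Import all_boot all_fingroup.
From Stdlib Require Relation_Operators.

(** Index permutations are awkward to glue, but words are easy to concatenate.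
    So [sim1 s t] is first restated: [s] and [t] are the products in S^1 of two
    nonempty words over S^1 that are rearrangements of each other
    ([sim1_permP]).  If (u1, v1) and (u2, v2) are such pairs of words for
    (s1, t1) and (s2, t2), then (u1 u2, v1 v2) is one for (s1 s2, t1 t2); hence
    [sim1] is compatible with products.

    The relation [sim1] is moreover reflexive, which is what lets its transitive
    closure inherit this compatibility: chains from [s1] to [t1] and from [s2]
    to [t2] may have different lengths, so the factors are moved one at a time,
    from s1 s2 to t1 s2 and then to t1 t2.  The claims on powers follow for any
    relation compatible with products, by induction on the exponent. *)

Set Implicit Arguments.
Unset Strict Implicit.
Unset Printing Implicit Defensive.

Local Open Scope group_scope.

Section ProductCongruence.
Variable S : semigroupType.
Implicit Types (s t : S) (R : S -> S -> Prop).

Definition mul_compatible R : Prop :=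
  forall s1 s2 t1 t2, R s1 t1 -> R s2 t2 -> R (s1 * s2) (t1 * t2).

Lemma mul_compatible_sgpow R s t n :
  mul_compatible R -> R s t -> (0 < n)%N -> R (sgpow s n) (sgpow t n).
Proof.
move=> mulR Rst; case: n => // n _.
rewrite /sgpow !iteropS; elim: n => //= n IHn.
exact: mulR.
Qed.

(** Reflexivity allows one factor to stay fixed while the other follows its
    chain; this makes the lengths of the two chains independent. *)
Lemma mul_compatible_clos_trans R :
  (forall s, R s s) -> mul_compatible R ->
  mul_compatible (@Relation_Operators.clos_trans S R).
Proof.
move=> reflR mulR s1 s2 t1 t2 R1 R2.
apply: (@Relation_Operators.t_trans _ _ _ (t1 * s2)).
- elim: R1 => [x y Rxy | x y z _ IHxy _ IHyz].
    exact/Relation_Operators.t_step/mulR.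
  exact: Relation_Operators.t_trans IHxy IHyz.
- elim: R2 => [x y Rxy | x y z _ IHxy _ IHyz].
    exact/Relation_Operators.t_step/mulR.
  exact: Relation_Operators.t_trans IHxy IHyz.
Qed.

(** A permutation of the positions of a word is the same thing as a
    rearrangement of the word: this trades the permutation of an index set,
    whose size would have to be cast under concatenation, for [perm_eq]. *)
Lemma sim1_permP s t :
  sim1 s t <->
  exists u v : seq (adjoin1 S),
    [/\ (0 < size u)%N, perm_eq u v,
        to_adjoin1 s = \prod_(x <- u) x & to_adjoin1 t = \prod_(x <- v) x].
Proof.
rewrite /sim1; split=> [[n [p [f [n_gt0 -> ->]]]] | [u [v [u_gt0 uv -> ->]]]].
  exists [tuple p i | i < n], [tuple p (f i) | i < n]; split.
  - by rewrite size_tuple.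
  - rewrite perm_sym; apply/tuple_permP; exists f; congr val.
    by apply: eq_mktuple => i; rewrite tnth_mktuple.
  - by rewrite big_tuple; apply: eq_bigr => i _; rewrite tnth_mktuple.
  - by rewrite big_tuple; apply: eq_bigr => i _; rewrite tnth_mktuple.
have/tuple_permP[f def_v] : perm_eq v (in_tuple u) by rewrite perm_sym.
exists (size u), (tnth (in_tuple u)), f; split=> //.
  by rewrite big_tnth.
by rewrite def_v big_tuple; apply: eq_bigr => i _; rewrite tnth_mktuple.
Qed.

Lemma sim1_refl s : sim1 s s.
Proof.
apply/sim1_permP; exists [:: to_adjoin1 s], [:: to_adjoin1 s].
by rewrite big_seq1.
Qed.

(** Concatenating rearranged words gives rearranged words. *)
Lemma sim1_mul : mul_compatible (@sim1 S).
Proof.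
move=> s1 s2 t1 t2 /sim1_permP[u1 [v1 [u1_gt0 uv1 s1E t1E]]].
case/sim1_permP=> u2 [v2 [_ uv2 s2E t2E]].
apply/sim1_permP; exists (u1 ++ u2), (v1 ++ v2); split.
- by rewrite size_cat addn_gt0 u1_gt0.
- exact: perm_cat.
- by rewrite to_adjoin1M s1E s2E big_cat.
- by rewrite to_adjoin1M t1E t2E big_cat.
Qed.

Lemma sim_mul : mul_compatible (@sim S).
Proof. exact: mul_compatible_clos_trans sim1_refl sim1_mul. Qed.

End ProductCongruence.

Local Close Scope group_scope.

Theorem lemma12 (S : semigroupType) (s1 s2 t1 t2 : S) :
  [/\ sim1 s1 t1 -> sim1 s2 t2 -> sim1 (s1 * s2)%g (t1 * t2)%g,
      sim s1 t1 -> sim s2 t2 -> sim (s1 * s2)%g (t1 * t2)%g,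
      sim1 s1 t1 -> forall n : nat, 0 < n -> sim1 (sgpow s1 n) (sgpow t1 n)
    & sim s1 t1 -> forall n : nat, 0 < n -> sim (sgpow s1 n) (sgpow t1 n)].
Proof.
split.
- exact: sim1_mul.
- exact: sim_mul.
- by move=> st n; apply: mul_compatible_sgpow (@sim1_mul S) st.
- by move=> st n; apply: mul_compatible_sgpow (@sim_mul S) st.
Qed.
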